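(* Let $k\ge 1$ and let $P\subset\mathbb{R}^k$ be the union of a finite (nonempty) collection of compact path-connected sets. Then the nearest neighbor metric and the edge-squared metric of $P$ coincide on $P$: for all $a,b\in P$, $$\mathbf{d}_N(a,b)=\mathbf{d}_2(a,b).$$
   Context: $\|\cdot\|$ is the Euclidean norm. For a nonempty compact $P\subset\mathbb{R}^k$ let $\mathbf{r}_P(z)=4\min_{x\in P}\|x-z\|$ for $z\in\mathbb{R}^k$. For $a,b\in\mathbb{R}^k$ let $\mathrm{path}(a,b)$ be the set of piecewise-$C^1$ (continuous) paths $\gamma:[0,1]\to\mathbb{R}^k$ with $\gamma(0)=a$, $\gamma(1)=b$. The nearest neighbor metric of $P$ is $$\mathbf{d}_N(a,b)=\inf_{\gamma\in\mathrm{path}(a,b)}\int_0^1\mathbf{r}_P(\gamma(t))\,\|\gamma'(t)\|\,dt .$$ The edge-squared metric of $P$ is, for $a,b\in P$, $$\mathbf{d}_2(a,b)=\inf_{(p_0,\dots,p_m)}\sum_{i=1}^m\|p_i-p_{i-1}\|^2,$$ the infimum being over all finite sequences $p_0,\dots,p_m\in P$ (of any length) with $p_0=a$ and $p_m=b$. A set consisting of finitely many points is the special case in which each set of the collection is a single point. *)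

(* Defs.v *)
From HB Require Import structures.
From mathcomp Require Import all_boot all_order all_algebra.
From mathcomp Require Import all_classical all_reals all_analysis.

Set Implicit Arguments.
Unset Strict Implicit.
Unset Printing Implicit Defensive.

Import Order.TTheory GRing.Theory Num.Theory.
Import numFieldNormedType.Exports.

Local Open Scope classical_set_scope.
Local Open Scope ring_scope.

(* The norm `|u| that MathComp-Analysis puts on 'rV[R]_k is the max norm. It
   induces the same topology as enorm, so compactness, continuity and
   derivatives in 'rV[R]_k are the library's. *)
Definition enorm (R : realType) (k : nat) (u : 'rV[R]_k) : R :=
  Num.sqrt (\sum_(j < k) u ord0 j ^+ 2).

Definition path_connected (R : realType) (T : topologicalType) (A : set T) :=
  forall x y, A x -> A y -> exists f : R -> T,
    [/\ {within `[0, 1], continuous f}, f 0 = x, f 1 = y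
      & forall t, t \in `[0, 1] -> A (f t)].

(* g is the derivative of f restricted to [x, y], hence one-sided at x and y. *)
Definition C1_on (R : realType) (k : nat) (f : R -> 'rV[R]_k) (x y : R) :=
  exists g : R -> 'rV[R]_k,
    {within `[x, y], continuous g} /\
    forall t, t \in `[x, y] ->
      (fun s => (s - t)^-1 *: (f s - f t)) @ within `[x, y] t^' --> g t.

Definition piecewise_C1 (R : realType) (k : nat) (f : R -> 'rV[R]_k) :=
  exists2 s : seq R, itv_partition 0 1 s &
    forall i, (i < size s)%N -> C1_on f (nth 0 (0 :: s) i) (nth 0 s i).

(* Only the values of f on [0, 1] matter. *)
Definition C1_paths (R : realType) (k : nat) (a b : 'rV[R]_k) :
    set (R -> 'rV[R]_k) :=
  [set f : R -> 'rV[R]_k | [/\ {within `[0, 1], continuous f}, piecewise_C1 f,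
               f 0 = a & f 1 = b]].

Definition nn_weight (R : realType) (k : nat) (P : set 'rV[R]_k)
    (z : 'rV[R]_k) : R :=
  4 * inf [set enorm (x - z) | x in P].

(* At the finitely many t in [0, 1] where f has no (two-sided) derivative,
   derive1 f t is an arbitrary value, which does not affect the integral. *)
Definition nn_length (R : realType) (k : nat) (P : set 'rV[R]_k)
    (f : R -> 'rV[R]_k) : \bar R :=
  (\int[@lebesgue_measure R]_(t in `[0%R, 1%R])
     (nn_weight P (f t) * enorm (derive1 f t))%:E)%E.

Definition nn_metric (R : realType) (k : nat) (P : set 'rV[R]_k)
    (a b : 'rV[R]_k) : \bar R :=
  ereal_inf [set nn_length P f | f in C1_paths a b].

Definition edge_squared_metric (R : realType) (k : nat) (P : set 'rV[R]_k)
    (a b : 'rV[R]_k) : \bar R :=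
  ereal_inf [set r | exists (m : nat) (p : nat -> 'rV[R]_k),
    [/\ p 0%N = a, p m = b, forall i, (i <= m)%N -> P (p i)
      & r = (\sum_(i < m) enorm (p i.+1 - p i) ^+ 2)%:E]].

(* Main.v *)
Require Import Defs.
From HB Require Import structures.
From mathcomp Require Import all_boot all_order all_algebra.
From mathcomp Require Import all_classical all_reals all_analysis.
From mathcomp Require Import measurable_realfun ring lra.
Import Order.TTheory GRing.Theory Num.Theory.
Import numFieldNormedType.Exports.

(* A segment from p to q has length at most |q - p|^2, since the weight on it is
   at most 4 times the distance to the nearer end; hence d_N <= d_2.

   Conversely let f = d_2(a, -), so that |f p - f q| <= |p - q|^2 on P. Embedding
   the line with the metric |s - t|^(1/2) in a Hilbert space, by
   s |-> 1_[0, s] in L^2, turns f into a 1-Lipschitz map on P, which Kirszbraun's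
   theorem extends to R^k. Followed by G u = \int ramp (u s) ds, where ramp has
   derivative 4 min(|u|, |u - 1|), it gives a function that restricts to f on P
   up to a constant and whose gradient has norm at most 4 times the distance
   to P, because the values of 1_[0, s] are 0 and 1. Integrating this gradient
   bound along a path gives d_2 <= d_N. A discrete form of the bound, for finite
   chains of points of the path, needs Kirszbraun's theorem for finite sets only,
   and step functions in place of L^2. *)

Set Implicit Arguments.
Unset Strict Implicit.
Unset Printing Implicit Defensive.
Local Open Scope classical_set_scope.
Local Open Scope ring_scope.

(** * Weighted inner products on row vectors *)

(** With the lengths of the intervals of a partition as weights, row vectors stand for step
    functions in $L^2$; with all weights 1 this is the Euclidean inner product. *)
HB.lock Definition dot (R : realType) (m : nat) (w : 'I_m -> R) (u v : 'rV[R]_m) : R :=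
  \sum_i w i * (u ord0 i * v ord0 i).

Section Dot.
Context {R : realType} {m : nat} (w : 'I_m -> R).
Implicit Types u v z : 'rV[R]_m.

Lemma dotC u v : dot w u v = dot w v u.
Proof. by rewrite dot.unlock; apply: eq_bigr => i _; rewrite [u _ _ * _]mulrC. Qed.

Lemma dotDl u v z : dot w (u + v) z = dot w u z + dot w v z.
Proof.
by rewrite dot.unlock -big_split; apply: eq_bigr => i _ /=; rewrite mxE; ring.
Qed.

Lemma dotDr u v z : dot w z (u + v) = dot w z u + dot w z v.
Proof. by rewrite dotC dotDl !(dotC _ z). Qed.

Lemma dotZl c u v : dot w (c *: u) v = c * dot w u v.
Proof. by rewrite dot.unlock mulr_sumr; apply: eq_bigr => i _; rewrite mxE; ring. Qed.

Lemma dotZr c u v : dot w u (c *: v) = c * dot w u v.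
Proof. by rewrite dotC dotZl dotC. Qed.

Lemma dotNl u v : dot w (- u) v = - dot w u v.
Proof. by rewrite -scaleN1r dotZl mulN1r. Qed.

Lemma dotNr u v : dot w u (- v) = - dot w u v.
Proof. by rewrite dotC dotNl dotC. Qed.

Definition dotE := (dotDl, dotDr, dotNl, dotNr, dotZl, dotZr).

Lemma dot0l v : dot w 0 v = 0.
Proof. by rewrite -(scale0r 0) dotZl mul0r. Qed.

Lemma dot_suml n (F : 'I_n -> 'rV[R]_m) v :
  dot w (\sum_i F i) v = \sum_i dot w (F i) v.
Proof.
apply: (big_morph (fun u => dot w u v)) => [u u'|]; first exact: dotDl.
exact: dot0l.
Qed.

Lemma dot_sqrB u v : dot w (u - v) (u - v) = dot w u u - 2 * dot w u v + dot w v v.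
Proof. by rewrite !dotE (dotC v u); ring. Qed.

(** With the [l i] read as probabilities, this is $E|Y-Y'|^2 = 2E|Y|^2 - 2|EY|^2$ for independent
    copies $Y, Y'$. It passes from pairwise distances to barycentres. *)
Lemma weighted_variance n (l : 'I_n -> R) (y : 'I_n -> 'rV[R]_m) :
  \sum_i l i = 1 ->
  \sum_i \sum_j l i * l j * dot w (y i - y j) (y i - y j) =
  2 * (\sum_i l i * dot w (y i) (y i)) -
  2 * dot w (\sum_i l i *: y i) (\sum_i l i *: y i).
Proof.
move=> l1; pose yl := \sum_i l i *: y i.
have row i : \sum_j l i * l j * dot w (y i - y j) (y i - y j) =
    l i * dot w (y i) (y i) - 2 * (l i * dot w (y i) yl) +
    l i * (\sum_j l j * dot w (y j) (y j)).
  rewrite (dotC _ yl) /yl dot_suml !mulr_sumr -sumrN.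
  rewrite -[l i * dot w _ _]mulr1 -{1}l1 mulr_sumr -!big_split /=.
  by apply: eq_bigr => j _; rewrite dot_sqrB dotZl (dotC (y j)); ring.
rewrite (eq_bigr _ (fun i _ => row i)) !big_split /= -mulr_suml l1 sumrN -mulr_sumr.
suff -> : \sum_i l i * dot w (y i) yl = dot w yl yl by ring.
by rewrite {2}/yl dot_suml; apply: eq_bigr => i _; rewrite dotZl.
Qed.

Hypothesis w_ge0 : forall i, 0 <= w i.

Lemma dot_ge0 u : 0 <= dot w u u.
Proof.
by rewrite dot.unlock; apply: sumr_ge0 => i _; rewrite mulr_ge0 // -expr2 sqr_ge0.
Qed.

(** Weights may vanish, so the form is only semidefinite. The discriminant argument works if [C] or
    [A] is positive; if both vanish, the square of [u - B *: v] forces [B] to be 0. *)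
Lemma dot_cauchy_schwarz u v : dot w u v ^+ 2 <= dot w u u * dot w v v.
Proof.
set A := dot w u u; set B := dot w u v; set C := dot w v v.
have E c d : 0 <= c ^+ 2 * A - 2 * c * d * B + d ^+ 2 * C.
  by have := dot_ge0 (c *: u - d *: v); rewrite dot_sqrB !dotE -/A -/B -/C; nra.
have := dot_ge0 u; have := dot_ge0 v; rewrite -/A -/C => C0 A0.
have [CP|] := ltP 0 C.
  by rewrite -(ler_pM2l CP); have := E C B; nra.
move=> C1; have {C1 C0}-C0 : C = 0 by apply/eqP; rewrite eq_le C1.
have [AP|] := ltP 0 A.
  by rewrite -(ler_pM2l AP); have := E B A; rewrite C0; nra.
by move=> A1; have := E 1 B; rewrite C0; nra.
Qed.

Lemma dot_le_norms u v (A B : R) : 0 <= A -> 0 <= B ->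
  dot w u u <= A ^+ 2 -> dot w v v <= B ^+ 2 -> dot w u v <= A * B.
Proof.
move=> A0 B0 uA vB; rewrite (le_trans (ler_norm _))//.
rewrite -(@ler_pXn2r _ 2) ?nnegrE ?mulr_ge0// real_normK ?num_real// exprMn.
by rewrite (le_trans (dot_cauchy_schwarz _ _))// ler_pM ?dot_ge0.
Qed.

End Dot.

(** * Kirszbraun's theorem for finite sets *)

Section Kirszbraun.
Context {R : realType} {k m : nat} (v : 'I_k -> R) (w : 'I_m -> R).
Hypotheses (v_ge0 : forall i, 0 <= v i) (w_ge0 : forall i, 0 <= w i).

(** A continuous function on the compact standard simplex attains its maximum; the maximiser will
    supply the new point in Kirszbraun's extension. *)
Lemma simplex_max n (c : 'I_n.+1 -> R) (y : 'I_n.+1 -> 'rV[R]_m) :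
  exists l : 'rV[R]_n.+1,
  [/\ forall i, 0 <= l ord0 i, \sum_i l ord0 i = 1 &
    forall l' : 'rV[R]_n.+1, (forall i, 0 <= l' ord0 i) -> \sum_i l' ord0 i = 1 ->
    let D (l : 'rV[R]_n.+1) := \sum_i l ord0 i * c i -
      dot w (\sum_i l ord0 i *: y i) (\sum_i l ord0 i *: y i) in
    D l' <= D l].
Proof.
pose D (l : 'rV[R]_n.+1) := \sum_i l ord0 i * c i -
      dot w (\sum_i l ord0 i *: y i) (\sum_i l ord0 i *: y i).
pose A := [set l : 'rV[R]_n.+1 | (forall i, 0 <= l ord0 i) /\ \sum_i l ord0 i = 1].
have cont_sum p (F : 'I_p -> 'rV[R]_n.+1 -> R) :
    (forall i, continuous (F i)) -> continuous (fun l => \sum_i F i l).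
  by move=> cF; apply: continuous_big => [|i _]; [exact: add_continuous|exact: cF].
have cD : continuous D.
  have -> : D = fun l => \sum_i l ord0 i * c i -
      \sum_j w j * ((\sum_i l ord0 i * y i ord0 j) * (\sum_i l ord0 i * y i ord0 j)).
    apply/funext => l; rewrite /D dot.unlock; congr (_ - _).
    apply: eq_bigr => j _; rewrite !summxE.
    by congr (_ * (_ * _)); apply: eq_bigr => i _; rewrite mxE.
  have lin (e : 'I_n.+1 -> R) : continuous (fun l : 'rV[R]_n.+1 => \sum_i l ord0 i * e i).
    apply: cont_sum => i l.
    exact: (continuousM (@coord_continuous _ _ _ ord0 i l) (@cst_continuous _ _ (e i) _)).
  have quad : continuous (fun l : 'rV[R]_n.+1 => \sum_j w j *
      ((\sum_i l ord0 i * y i ord0 j) * (\sum_i l ord0 i * y i ord0 j))).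
    apply: cont_sum => j l.
    exact: (continuousM (@cst_continuous _ _ (w j) _) (continuousM (lin _ _) (lin _ _))).
  by move=> l; exact: (continuousB (lin c l) (quad l)).
have clA : closed A.
  have -> : A = (\bigcap_i [set l : 'rV[R]_n.+1 | 0 <= l ord0 i]) `&`
                [set l : 'rV[R]_n.+1 | \sum_i l ord0 i = 1].
    by apply/seteqP; split => l [l0 l1]; split => // i; [move=> _; exact: l0|exact: (l0 i I)].
  apply: closedI; first apply: closed_bigI => i _.
    apply: (@preimage_closed _ R (fun l : 'rV[R]_n.+1 => l ord0 i) [set x | 0 <= x]);
      last exact: closed_ge.
    by move=> l _; exact: coord_continuous.
  apply: (@preimage_closed _ R (fun l : 'rV[R]_n.+1 => \sum_i l ord0 i) [set x | x = 1]);
    last exact: closed_eq.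
  by move=> l _; apply: cont_sum => i; exact: coord_continuous.
have compA : compact A.
  apply: bounded_closed_compact => //; exists 1; split; first exact: num_real.
  move=> M M1 l [l0 l1] /=; rewrite [leLHS]/Num.norm /= mx_normrE.
  apply/bigmax_leP; split=> [|[i j] _ /=]; first exact: le_trans ler01 (ltW M1).
  rewrite ord1 ger0_norm// (le_trans _ (ltW M1))// -l1 (bigD1 j)//= lerDl.
  exact: sumr_ge0.
have A0 : A !=set0.
  exists (delta_mx ord0 ord0); split=> [i|]; first by rewrite mxE ler0n.
  rewrite (bigD1 ord0)//= mxE !eqxx big1 ?addr0// => i i0.
  by rewrite mxE (negbTE i0) andbF.
have [|l lA lmax] := @compact_EVT_max _ _ D A A0 compA.
  exact: continuous_subspaceT.
exists l; move: lA; rewrite inE => -[l0 l1]; split=> // l' l'0 l'1.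
by apply: (lmax l'); rewrite inE.
Qed.

(* One more point can always be added to a 1-Lipschitz map between finite sets:
   the concave function [D] of barycentric coordinates is nonpositive by
   comparing variances, and at a maximiser of [D] the barycentre is within the
   prescribed distances. *)
Lemma kirszbraun_point n (x : 'I_n -> 'rV[R]_k) (y : 'I_n -> 'rV[R]_m) (x0 : 'rV[R]_k) :
  (forall i j, dot w (y i - y j) (y i - y j) <= dot v (x i - x j) (x i - x j)) ->
  exists y0, forall i, dot w (y i - y0) (y i - y0) <= dot v (x i - x0) (x i - x0).
Proof.
case: n x y => [|n] x y xy; first by exists 0; case.
pose r i := dot v (x i - x0) (x i - x0).
(* With this [c], the function D at [l] is the mean excess $\sum_i l_i(|y_i - y_l|^2 - r_i)$, where
   $y_l=\sum_i l_i y_i$. *)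
pose c i := dot w (y i) (y i) - r i.
have [l [l0 l1 lmax]] := simplex_max c y.
pose yl := \sum_i l ord0 i *: y i.
pose A := \sum_i l ord0 i * c i.
have D_le0 : A - dot w yl yl <= 0.
  have := weighted_variance v (fun i => x i - x0) l1.
  have := weighted_variance w y l1; rewrite -/yl.
  set Sy := \sum_i _; set Sx := \sum_i _; set Ny := \sum_i _; set Nx := \sum_i _.
  have Sle : Sy <= Sx.
    apply: ler_sum => i _; apply: ler_sum => j _.
    rewrite ler_wpM2l ?mulr_ge0//.
    by have -> : x i - x0 - (x j - x0) = x i - x j by rewrite opprB addrA subrK.
  have := dot_ge0 v_ge0 (\sum_i l ord0 i *: (x i - x0)).
  have -> : A = Ny - Nx.
    by rewrite /A /Ny /Nx -sumrB; apply: eq_bigr => i _; rewrite -mulrBr.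
  by move: Sle; lra.
exists yl => j; rewrite -/(r j).
(* [B] is the derivative of D at the maximiser [l] in the direction of the vertex [j]. Moving there
   by [t] changes D by $tB - t^2|y_j - y_l|^2$, which maximality makes nonpositive. *)
pose B := c j - A - 2 * dot w yl (y j - yl).
have key t : 0 < t -> t <= 1 -> B <= t * dot w (y j - yl) (y j - yl).
  move=> t0 t1.
  pose l' : 'rV[R]_n.+1 := (1 - t) *: l + t *: delta_mx ord0 j.
  (* Stated for any module, to serve the vectors [y] as well as the scalars [c] and the constant
     1. *)
  have sumE (V : lmodType R) (F : 'I_n.+1 -> V) :
      \sum_i l' ord0 i *: F i = (1 - t) *: (\sum_i l ord0 i *: F i) + t *: F j.
    have -> : t *: F j = \sum_i (t * (i == j)%:R) *: F i.
      rewrite (bigD1 j)//= eqxx mulr1 big1 ?addr0// => i /negbTE ->.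
      by rewrite mulr0 scale0r.
    rewrite scaler_sumr -big_split; apply: eq_bigr => i _ /=.
    by rewrite !mxE eqxx /= scalerA -scalerDl.
  have l'0 i : 0 <= l' ord0 i.
    by rewrite !mxE eqxx /=; have := l0 i; case: (i == j) => /=; nra.
  have l'1 : \sum_i l' ord0 i = 1.
    have := @sumE R^o (fun=> 1); under eq_bigr do rewrite /GRing.scale /= mulr1.
    move=> ->; rewrite /GRing.scale /=; under eq_bigr do rewrite mulr1.
    by rewrite l1; ring.
  have := lmax l' l'0 l'1; rewrite /= (sumE _ y) -/yl -/A.
  have -> : \sum_i l' ord0 i * c i = (1 - t) * A + t * c j.
    exact: (@sumE R^o c).
  rewrite /B !dotE !(dotC w yl (y j)) => le_l; rewrite -(ler_pM2l t0); lra.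
have B_le0 : B <= 0.
  rewrite leNgt; apply/negP => B0.
  pose N := dot w (y j - yl) (y j - yl).
  have N0 : 0 <= N := dot_ge0 w_ge0 _.
  have := key 1 ltr01 (lexx _); rewrite mul1r -/N => BN.
  (* At [t = B / (2 * N)] the bound [key] reads [B <= B / 2]; [BN] ensures [t <= 1]. *)
  have := key (B / (2 * N)); rewrite -/N.
  have NP : 0 < N by exact: lt_le_trans BN.
  have -> : B / (2 * N) * N = B / 2 by field; rewrite gt_eqF.
  rewrite divr_gt0 ?mulr_gt0// ler_pdivrMr ?mulr_gt0//.
  by move=> /(_ isT); lra.
(* The sum of [B] and of D at [l] is exactly $|y_j - y_l|^2 - r_j$. *)
move: B_le0 D_le0; rewrite /B /c !dotE !(dotC w yl (y j)); lra.
Qed.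

(** The points of [L] are added one at a time. A point already present keeps its value, which
    preserves the agreement with [phi] on [B]. *)
Lemma kirszbraun_extension (B L : seq 'rV[R]_k) (phi : 'rV[R]_k -> 'rV[R]_m) :
  {in B &, forall p q, dot w (phi p - phi q) (phi p - phi q) <= dot v (p - q) (p - q)} ->
  exists2 psi : 'rV[R]_k -> 'rV[R]_m, {in B, psi =1 phi} &
  {in L ++ B &, forall p q, dot w (psi p - psi q) (psi p - psi q) <= dot v (p - q) (p - q)}.
Proof.
move=> phi_lip; elim: L => [|x0 L [psi psiE psi_lip]]; first by exists phi.
have [x0LB|x0LB] := boolP (x0 \in L ++ B).
  by exists psi => // p q; rewrite !inE =>
    /predU1P[->|pLB] /predU1P[->|qLB]; apply: psi_lip.
pose x (i : 'I_(size (L ++ B))) := nth 0 (L ++ B) i.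
have [i j|y0 hy0] := @kirszbraun_point _ x (psi \o x) x0.
  by apply: psi_lip; apply: mem_nth.
have {}hy0 p : p \in L ++ B -> dot w (psi p - y0) (psi p - y0) <= dot v (p - x0) (p - x0).
  move=> pLB; have ip : (index p (L ++ B) < size (L ++ B))%N by rewrite index_mem.
  by have := hy0 (Ordinal ip); rewrite /x /= nth_index.
have dotNN n (u : 'I_n -> R) (s t : 'rV[R]_n) :
    dot u (s - t) (s - t) = dot u (t - s) (t - s) by rewrite -opprB dotNl dotNr opprK.
exists (fun p => if p == x0 then y0 else psi p) => [p pB|p q].
  rewrite ifF ?psiE//; apply: contraNF x0LB => /eqP <-.
  by rewrite mem_cat pB orbT.
rewrite !inE; case: eqVneq => [->|_] /= pLB; case: eqVneq => [->|_] /= qLB.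
- by rewrite !subrr !dot0l.
- by rewrite dotNN (dotNN _ v) hy0.
- exact: hy0.
- exact: psi_lip.
Qed.

End Kirszbraun.

(** * The potential and the discretised screw line *)

Section Potential.
Context {R : realType}.

(* The primitive of [4 * min(|u|, |u - 1|)] that vanishes at 0; it equals 1 at 1. *)
Definition ramp (u : R) : R :=
  if 2 * u <= 1 then 2 * (u * `|u|) else 1 - 2 * ((1 - u) * `|1 - u|).

Definition dramp (u : R) : R := 4 * Num.min `|u| `|1 - u|.

Lemma ramp0 : ramp 0 = 0.
Proof. by rewrite /ramp mulr0 ler01 mul0r mulr0. Qed.

Lemma ramp1 : ramp 1 = 1.
Proof.
rewrite /ramp ifF ?subrr ?mul0r ?mulr0 ?subr0//.
by apply/negbTE; rewrite -ltNge; lra.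
Qed.

Lemma drampE u : dramp u = if 2 * u <= 1 then 4 * `|u| else 4 * `|1 - u|.
Proof.
rewrite /dramp; case: (leP (2 * u) 1) => hu; case: leP;
  case: (ger0P u); case: (ger0P (1 - u)); lra.
Qed.

(** The derivative [dramp] is 4-Lipschitz, so the first-order Taylor remainder is at most
    $\frac{4}{2}(t-u)^2$. The code checks this on each combination of pieces. *)
Lemma ramp_taylor u t : `|ramp t - ramp u - dramp u * (t - u)| <= 2 * (t - u) ^+ 2.
Proof.
rewrite drampE /ramp ler_norml; apply/andP.
case: (leP (2 * u) 1) => hu; case: (leP (2 * t) 1) => ht;
  case: (ger0P u) => u0; case: (ger0P (1 - u)) => u1; case: (ger0P t) => t0;
  case: (ger0P (1 - t)) => t1; split; have := sqr_ge0 (t - u); nra.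
Qed.

Definition potential m (w : 'I_m -> R) (u : 'rV[R]_m) := \sum_i w i * ramp (u ord0 i).

(** By [ramp_taylor] the increment is at most $\langle d, v-u\rangle + 2|v-u|^2$. Since every
    coordinate of [e] is 0 or 1, $d_i \le 4|e_i-u_i|$, hence $|d|\le 4A$, and Cauchy-Schwarz
    concludes. *)
Lemma potential_step m (w : 'I_m -> R) (e u v : 'rV[R]_m) (A B : R) :
  (forall i, 0 <= w i) -> (forall i, e ord0 i = 0 \/ e ord0 i = 1) ->
  0 <= A -> 0 <= B ->
  dot w (e - u) (e - u) <= A ^+ 2 -> dot w (v - u) (v - u) <= B ^+ 2 ->
  potential w v - potential w u <= 4 * A * B + 2 * B ^+ 2.
Proof.
move=> w0 e01 A0 B0 euA vuB.
pose d : 'rV[R]_m := \row_i dramp (u ord0 i).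
have dA : dot w d d <= (4 * A) ^+ 2.
  apply: (@le_trans _ _ (16 * dot w (e - u) (e - u))); last by lra.
  rewrite dot.unlock mulr_sumr; apply: ler_sum => i _; rewrite [leRHS]mulrCA ler_wpM2l// !mxE.
  have : 0 <= dramp (u ord0 i) <= 4 * `|e ord0 i - u ord0 i|.
    rewrite /dramp mulr_ge0 ?le_min ?normr_ge0//= ler_pM2l// ge_min.
    by case: (e01 i) => ->; rewrite ?sub0r ?normrN lexx ?orbT.
  rewrite -[X in 16 * X]expr2 -[X in 16 * X]real_normK ?num_real// => /andP[]; nra.
rewrite (@le_trans _ _ (dot w d (v - u) + 2 * dot w (v - u) (v - u)))//.
  rewrite dot.unlock -sumrB mulr_sumr -big_split; apply: ler_sum => i _ /=; rewrite !mxE.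
  rewrite -mulrBr [2 * _]mulrCA -mulrDr ler_wpM2l//.
  by have := ramp_taylor (u ord0 i) (v ord0 i); rewrite ler_norml => /andP[_]; lra.
by rewrite lerD ?ler_pM2l// dot_le_norms// mulr_ge0.
Qed.

(* Schoenberg's screw line, discretised: [s] goes to the indicator of [0, s], so
   that squared distances in the weighted norm are the distances of the line. *)
Lemma step_embedding (T : seq R) : exists m (w : 'I_m -> R) (e : R -> 'rV[R]_m),
  [/\ forall i, 0 <= w i, forall t i, e t ord0 i = 0 \/ e t ord0 i = 1,
    {in T &, forall s t, dot w (e s - e t) (e s - e t) = `|s - t|} &
    {in T &, forall s t, potential w (e s) - potential w (e t) = s - t}].
Proof.
(* Coordinates correspond to the gaps between consecutive entries of the sorted list, weighted by
   their lengths. Repeated entries only create gaps of weight 0. *)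
pose S := sort <=%R T; pose m := (size S).-1.
pose w (i : 'I_m) := S`_i.+1 - S`_i.
pose e t : 'rV[R]_m := \row_i (i < index t S)%N%:R.
have e01 t i : e t ord0 i = 0 \/ e t ord0 i = 1.
  by rewrite mxE; case: ltnP => _; [right|left].
have w0 i : 0 <= w i.
  rewrite subr_ge0; apply: (sorted_leq_nth le_trans lexx) => //.
  - exact: (sort_sorted le_total).
  - by rewrite inE (leq_trans (ltn_ord i))// leq_pred.
  - by rewrite inE -ltn_predRL ltn_ord.
have sumE t : t \in T -> \sum_i w i * e t ord0 i = t - S`_0.
  move=> tT; have tS : t \in S by rewrite mem_sort.
  have tm : (index t S <= m)%N.
    by move: tS; rewrite -index_mem /m; case: (size S).
  rewrite -[X in _ = X - _](nth_index 0 tS) -(telescope_sumr _ (leq0n _)) big_mkord.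
  rewrite (big_ord_widen _ (fun i => S`_i.+1 - S`_i) tm) [RHS]big_mkcond.
  by apply: eq_bigr => i _; rewrite mxE; case: ltnP; rewrite ?mulr1 ?mulr0.
have distE s t : s \in T -> t \in T -> (index s S <= index t S)%N ->
    dot w (e s - e t) (e s - e t) = t - s.
  move=> sT tT st; have -> : t - s = \sum_i w i * e t ord0 i - \sum_i w i * e s ord0 i.
    by rewrite !sumE//; ring.
  rewrite dot.unlock -sumrB; apply: eq_bigr => i _; rewrite !mxE.
  have [is_|_] := ltnP i (index s S); first by rewrite (leq_trans is_ st) /=; ring.
  by case: ltnP => _ /=; ring.
exists m, w, e; split=> // s t sT tT.
  case: (leqP (index s S) (index t S)) => [|/ltnW] st.
    have := dot_ge0 w0 (e s - e t).
    by rewrite distE// distrC => ts; rewrite ger0_norm.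
  have := dot_ge0 w0 (e t - e s).
  by rewrite -[e s - e t]opprB dotNl dotNr opprK distE// => ts; rewrite ger0_norm.
(* [ramp] fixes 0 and 1, so on an indicator vector the potential is the total length of the gaps
   below [r]. *)
have potE r : r \in T -> potential w (e r) = r - S`_0.
  by move=> /sumE <-; apply: eq_bigr => i _; case: (e01 r i) => ->; rewrite ?ramp0 ?ramp1.
by rewrite !potE//; ring.
Qed.

End Potential.

(** * The lower bound for costs of finite chains *)

Section DiscreteBound.
Context {R : realType} {k : nat}.
Implicit Types (p q z u v : 'rV[R]_k) (P : set 'rV[R]_k) (l : seq ('rV[R]_k * 'rV[R]_k)).

Lemma enorm_ge0 u : 0 <= enorm u.
Proof. exact: sqrtr_ge0. Qed.

Lemma enorm_sqr u : enorm u ^+ 2 = dot (fun=> 1) u u.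
Proof.
rewrite sqr_sqrtr ?dot.unlock; last by apply: sumr_ge0 => i _; exact: sqr_ge0.
by apply: eq_bigr => i _; rewrite mul1r.
Qed.

(* A step [(p, z')] of a chain at [z] goes to [z'] and is charged by the
   distance of [z] to the point [p] instead of its distance to [P]. *)
Fixpoint chain_cost z l : R :=
  if l is (p, z') :: l' then
    4 * enorm (p - z) * enorm (z' - z) + 2 * enorm (z' - z) ^+ 2 + chain_cost z' l'
  else 0.

(** On the finite set of tags and end points, [e \o f] is 1-Lipschitz, because its squared distances
    are $|f(p)-f(q)|\le|p-q|^2$. Kirszbraun extends it to the points of the chain. At a tag the
    extension is still a 0/1 vector, so [potential_step] bounds each increment of the potential by
    the cost of that step, and the increments telescope. *)
Lemma chain_lower_bound P (f : 'rV[R]_k -> R) z l :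
  (forall p q, P p -> P q -> f q - f p <= enorm (q - p) ^+ 2) ->
  (forall s, s \in l -> P s.1) -> P z -> P (last z (unzip2 l)) ->
  f (last z (unzip2 l)) - f z <= chain_cost z l.
Proof.
move=> f_lip tagP Pz Pend.
pose B := [:: z, last z (unzip2 l) & unzip1 l].
have BP p : p \in B -> P p.
  rewrite !inE => /predU1P[->//|/predU1P[->//|]].
  by move=> /mapP[s /tagP Ps ->].
have [m [w [e [w0 e01 edist epot]]]] := step_embedding (map f B).
have v0 (i : 'I_k) : 0 <= (fun=> 1 : R) i := ler01.
have [|psi psiE psi_lip] := @kirszbraun_extension _ _ _ (fun=> 1) w v0 w0 B (unzip2 l) (e \o f).
  move=> p q pB qB /=; rewrite edist ?map_f// -enorm_sqr.
  have [Pp Pq] := (BP p pB, BP q qB); rewrite ler_norml f_lip// andbT lerNl opprB.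
  by rewrite (le_trans (f_lip _ _ Pp Pq))// -opprB !enorm_sqr dotNl dotNr opprK.
have tB s : s \in l -> s.1 \in B by move=> sl; rewrite !inE [_ \in unzip1 _]map_f ?orbT.
have zB : z \in B by rewrite inE eqxx.
have lB : last z (unzip2 l) \in B by rewrite !inE eqxx orbT.
rewrite -epot ?map_f// -[e (f (last _ _))](psiE _ lB) -[e (f z)](psiE _ zB).
pose X := unzip2 l ++ B.
have BX p : p \in B -> p \in X by move=> pB; rewrite mem_cat pB orbT.
have lX s : s \in l -> s.1 \in B /\ s.2 \in X.
  by move=> sl; rewrite tB// mem_cat map_f.
suff main l' z' : (forall s, s \in l' -> s.1 \in B /\ s.2 \in X) -> z' \in X ->
    potential w (psi (last z' (unzip2 l'))) - potential w (psi z') <= chain_cost z' l'.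
  by apply: main => //; exact: BX.
elim: l' z' => [|[p z2] l' IH] z1 l'X z1X /=; first by rewrite subrr.
have [/= pB z2X] := l'X _ (mem_head _ _).
have : potential w (psi (last z2 (unzip2 l'))) - potential w (psi z2) <= chain_cost z2 l'.
  by apply: IH => // s sl; apply: l'X; rewrite inE sl orbT.
suff : potential w (psi z2) - potential w (psi z1) <=
  4 * enorm (p - z1) * enorm (z2 - z1) + 2 * enorm (z2 - z1) ^+ 2.
  by move=> h1 h2; rewrite -(subrKA (potential w (psi z2))) addrC lerD.
apply: (@potential_step _ _ _ (psi p)) => // [i||||].
- by rewrite psiE//; exact: e01.
- exact: enorm_ge0.
- exact: enorm_ge0.
- by rewrite enorm_sqr psi_lip// BX.
- by rewrite enorm_sqr psi_lip.
Qed.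

End DiscreteBound.

(** * Induction along a segment and a continuity criterion *)

Section Analysis.
Context {R : realType}.

(** Let [c] be the supremum of the [t] with [Q x t]. The local hypothesis at [c] gives [Q x c], and
    then [Q x s'] for some [s'] beyond [c] unless [c = y]. The start [Q x x] is the local hypothesis
    with [s = t]. *)
Lemma segment_induction (x y : R) (Q : R -> R -> Prop) : x <= y ->
  (forall s t u, x <= s -> s <= t -> t <= u -> u <= y -> Q s t -> Q t u -> Q s u) ->
  (forall t, x <= t <= y -> exists2 d, 0 < d & forall s, x <= s <= y ->
     `|s - t| < d -> (s <= t -> Q s t) /\ (t <= s -> Q t s)) ->
  Q x y.
Proof.
move=> xy Qtrans Qloc; pose S := [set t | x <= t <= y /\ Q x t].
have Sx : S x.
  have [|d d0 /(_ x)] := Qloc x; rewrite lexx xy// subrr normr0 => /(_ isT d0)[Qx _].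
  by split; [rewrite lexx xy|exact: Qx].
have ubS : has_ubound S by exists y => t [/andP[]].
have supS : has_sup S by split => //; exists x.
pose c := sup S.
have xc : x <= c by exact: ub_le_sup.
have cy : c <= y by apply: ge_sup => [|t [/andP[]]]; first by exists x.
have [|d d0 Qd] := Qloc c; first by rewrite xc.
have [s [/andP[xs sy] Qxs] cds] := sup_adherent d0 supS.
have sc : s <= c by apply: ub_le_sup => //; split => //; rewrite xs.
have Qxc : Q x c.
  have scd : `|s - c| < d by rewrite ler0_norm ?subr_le0// opprB; move: cds; rewrite -/c; lra.
  have sxy : x <= s <= y by rewrite xs.
  by have [/(_ sc) Qsc _] := Qd s sxy scd; apply: (Qtrans _ s).
have [->//|yc] := eqVneq y c.
have {}cy : c < y by rewrite lt_neqAle eq_sym yc.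
pose s' := Num.min y (c + d / 2).
have cs' : c < s' by rewrite lt_min cy/=; lra.
have s'y : s' <= y by rewrite ge_min lexx.
have s'xy : x <= s' <= y by rewrite s'y (le_trans xc (ltW cs')).
have s'cd : `|s' - c| < d.
  have : s' <= c + d / 2 by rewrite ge_min lexx orbT.
  by rewrite gtr0_norm ?subr_gt0//; lra.
have [_ /(_ (ltW cs')) Qcs'] := Qd s' s'xy s'cd.
have : s' <= c by apply: ub_le_sup => //; split => //; apply: (Qtrans _ c) => //; exact: ltW.
by rewrite leNgt cs'.
Qed.

Lemma continuous_dominated (T : topologicalType) (h d : T -> R) (z : T) :
  {for z, continuous d} -> d z = 0 -> (forall u, `|h z - h u| <= d u) ->
  {for z, continuous h}.
Proof.
move=> cd dz0 hd; apply/cvgrPdist_lt => eps eps0.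
move/cvgrPdist_lt : cd => /(_ _ eps0); rewrite dz0; apply: filterS => u.
rewrite sub0r normrN; apply: le_lt_trans; exact: le_trans (hd u) (ler_norm _).
Qed.

End Analysis.

(** * The Euclidean norm and the nearest neighbor weight *)

Section EuclideanNorm.
Context {R : realType} {k : nat}.
Implicit Types (u v z : 'rV[R]_k) (P : set 'rV[R]_k).

Let one_ge0 (i : 'I_k) : 0 <= (fun=> 1 : R) i := ler01.

Lemma enormZ c u : enorm (c *: u) = `|c| * enorm u.
Proof.
rewrite /enorm -sqrtr_sqr -sqrtrM ?sqr_ge0// mulr_sumr; congr Num.sqrt.
by apply: eq_bigr => i _; rewrite mxE exprMn.
Qed.

Lemma enormN u : enorm (- u) = enorm u.
Proof. by rewrite -scaleN1r enormZ normrN1 mul1r. Qed.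

Lemma enormB u v : enorm (u - v) = enorm (v - u).
Proof. by rewrite -enormN opprB. Qed.

Lemma enormD u v : enorm (u + v) <= enorm u + enorm v.
Proof.
rewrite -(@ler_pXn2r _ 2) ?nnegrE ?addr_ge0 ?enorm_ge0//.
have := @dot_le_norms _ _ (fun=> 1) one_ge0 u v (enorm u) (enorm v).
rewrite sqrrD !enorm_sqr !dotE !enorm_ge0 !lexx (dotC _ v u) => /(_ isT isT isT isT).
lra.
Qed.

Lemma enorm_continuous : continuous (@enorm R k).
Proof.
move=> u; apply: (@continuous_comp _ _ _ (fun v : 'rV[R]_k => \sum_j v ord0 j ^+ 2) Num.sqrt).
  apply: continuous_big => [|i _]; first exact: add_continuous.
  move=> v.
  exact: (continuousM (@coord_continuous _ _ _ ord0 i v) (@coord_continuous _ _ _ ord0 i v)).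
exact: sqrt_continuous.
Qed.

Lemma nn_weight_ge0 P z : 0 <= nn_weight P z.
Proof.
(* The infimum of the empty set has the default value 0. *)
rewrite mulr_ge0//; have [->|P0] := eqVneq P set0; first by rewrite image_set0 inf0.
apply: lb_le_inf; last by move=> _ [q _ <-]; exact: enorm_ge0.
by apply: image_nonempty; exact/set0P.
Qed.

Lemma nn_weight_le P p z : P p -> nn_weight P z <= 4 * enorm (p - z).
Proof.
move=> Pp; rewrite ler_pM2l//; apply: ge_inf; last by exists p.
by exists 0 => _ [q _ <-]; exact: enorm_ge0.
Qed.

(** Such an almost nearest point of [P] serves as the tag of a chain step. *)
Lemma nn_weight_adherent P z (eps : R) : P !=set0 -> 0 < eps ->
  exists2 p, P p & 4 * enorm (p - z) <= nn_weight P z + eps.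
Proof.
move=> [p0 Pp0] eps0; have e4 : 0 < eps / 4 by rewrite divr_gt0.
have [|_ [p Pp <-] /ltW hp] := @inf_adherent _ [set enorm (x - z) | x in P] _ e4.
  split; first by exists (enorm (p0 - z)), p0.
  by exists 0 => _ [q _ <-]; exact: enorm_ge0.
by exists p => //; rewrite /nn_weight; lra.
Qed.

(** The weight is an infimum of the functions [4 * enorm (p - z)], each 4-Lipschitz in [z] by the
    triangle inequality. *)
Lemma nn_weight_lipschitz P u v : P !=set0 ->
  nn_weight P u <= nn_weight P v + 4 * enorm (u - v).
Proof.
move=> P0; apply/ler_addgt0Pr => eps eps0.
have [p Pp] := nn_weight_adherent v P0 eps0.
have := nn_weight_le u Pp; have := enormD (p - v) (v - u).
by rewrite addrA subrK (enormB v u); lra.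
Qed.

Lemma nn_weight_continuous P : P !=set0 -> continuous (nn_weight P).
Proof.
move=> P0 z; pose d (u : 'rV[R]_k) := 4 * enorm (z - u).
apply: (@continuous_dominated _ _ _ d).
- apply: (@continuous_comp _ _ _ (fun u => z - u) (fun u => 4 * enorm u)).
    exact: (continuousB (@cst_continuous _ _ z _) (@cvg_id _ (nbhs z))).
  apply: (@continuousM R _ (cst 4) (@enorm R k)); first exact: cst_continuous.
  exact: enorm_continuous.
- by rewrite /d subrr -(scale0r 0) enormZ normr0 mul0r mulr0.
- move=> u; have := nn_weight_lipschitz z u P0; have := nn_weight_lipschitz u z P0.
  by rewrite (enormB u z) ler_norml /d => ? ?; apply/andP; split; lra.
Qed.

End EuclideanNorm.

(** * Integrals over intervals and one chain step along a path *)

Section ChainAlongPath.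
Context {R : realType}.

Lemma within_continuous_dist (A : set R) (h : R -> R) (t eps : R) :
  {within A, continuous h} -> A t -> 0 < eps ->
  exists2 d, 0 < d & forall s, A s -> `|s - t| < d -> `|h t - h s| < eps.
Proof.
move=> /subspace_continuousP ch At eps0.
have /cvgrPdist_lt /(_ _ eps0) /nbhs_ballP[d d0 hd] := ch t At.
by exists d => // s As st; apply: hd => //; rewrite -ball_normE /= distrC.
Qed.

Lemma integral_itv_split (h : R -> R) (s t u : R) : s <= t -> t <= u ->
  (forall r, 0 <= h r) -> measurable_fun `[s, t] h -> measurable_fun `[t, u] h ->
  measurable_fun `[s, u] h /\
  (\int[@lebesgue_measure R]_(r in `[s, u]) (h r)%:E =
   \int[@lebesgue_measure R]_(r in `[s, t]) (h r)%:E +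
   \int[@lebesgue_measure R]_(r in `[t, u]) (h r)%:E)%E.
Proof.
move=> st tu h0 mst mtu.
have suE : `[s, u]%classic = `[s, t] `|` `]t, u] :> set R.
  by rewrite -itv_bndbnd_setU ?bnd_simp.
have mtu' : measurable_fun `]t, u] h.
  by apply: measurable_funS mtu => //; apply: subset_itv; rewrite bnd_simp.
have msu : measurable_fun `[s, u] h by rewrite suE; exact/measurable_funU.
split=> //; rewrite suE ge0_integral_setU//.
- by rewrite (@integral_itv_obnd_cbnd _ t (BRight u))//; exact/measurable_EFinP.
- by rewrite -suE; exact/measurable_EFinP.
- by move=> r _; rewrite lee_fin.
- apply/disj_setPS => r [] /=; rewrite !in_itv /= => /andP[_ rt] /andP[tr _].
  by move: (le_lt_trans rt tr); rewrite ltxx.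
Qed.

Lemma le_integral_itv (h : R -> R) (s t c : R) : s <= t ->
  (forall r, 0 <= h r) -> measurable_fun `[s, t] h ->
  (forall r, r \in `[s, t] -> c <= h r) ->
  ((c * (t - s))%:E <= \int[@lebesgue_measure R]_(r in `[s, t]) (h r)%:E)%E.
Proof.
move=> st h0 mh ch; have [c0|c0] := leP c 0.
  apply: (@le_trans _ _ 0%E); first by rewrite lee_fin mulr_le0_ge0// subr_ge0.
  by apply: integral_ge0 => r _; rewrite lee_fin.
apply: (@le_trans _ _ (\int[@lebesgue_measure R]_(r in `[s, t]) (cst c%:E r))%E).
  by rewrite integral_cst//= lebesgue_measure_itv /= lte_fin;
    case: ltP => ts; rewrite -EFinM// lee_fin; nra.
apply: ge0_le_integral => //.
- by move=> r _; rewrite lee_fin ltW.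
- exact/measurable_EFinP.
Qed.

Context {k : nat}.
Implicit Types (P : set 'rV[R]_k) (l : seq ('rV[R]_k * 'rV[R]_k)) (f g : R -> 'rV[R]_k).

Lemma chain_cost_cat (z : 'rV[R]_k) l1 l2 :
  chain_cost z (l1 ++ l2) = chain_cost z l1 + chain_cost (last z (unzip2 l1)) l2.
Proof.
by elim: l1 z => [|[p z'] l1 IH] z /=; rewrite ?add0r// IH addrA.
Qed.

Definition is_chain P (z z' : 'rV[R]_k) l :=
  (forall s, s \in l -> P s.1) /\ last z (unzip2 l) = z'.

Lemma is_chain_cat P z1 z2 z3 l1 l2 :
  is_chain P z1 z2 l1 -> is_chain P z2 z3 l2 -> is_chain P z1 z3 (l1 ++ l2).
Proof.
move=> [t1 e1] [t2 e2]; split=> [s|]; last by rewrite /unzip2 map_cat last_cat e1.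
by rewrite mem_cat => /orP[/t1|/t2].
Qed.

Lemma within_continuous_density P f g (A : set R) : P !=set0 ->
  {within A, continuous f} -> {within A, continuous g} ->
  {within A, continuous (fun t => nn_weight P (f t) * enorm (g t))}.
Proof.
move=> P0 cf cg r.
apply: (@continuousM R (subspace A) (nn_weight P \o f) (@enorm R k \o g)).
  apply: (@continuous_comp (subspace A) _ _ f); first exact: cf.
  exact: nn_weight_continuous.
apply: (@continuous_comp (subspace A) _ _ g); first exact: cg.
exact: enorm_continuous.
Qed.

(** Near [t] the path moves at speed about [enorm (g t)], so one step with an almost nearest tag
    costs about [rho t] per unit of time. Both directions are treated because [segment_induction]
    needs both sides of [t]. *)
Lemma chain_step_local P f g (x y t eps : R) : P !=set0 ->
  {within `[x, y], continuous f} -> {within `[x, y], continuous g} ->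
  t \in `[x, y] ->
  (fun s => (s - t)^-1 *: (f s - f t)) @ within `[x, y] t^' --> g t ->
  0 < eps ->
  let rho s := nn_weight P (f s) * enorm (g s) in
  exists2 d, 0 < d & forall s, s \in `[x, y] -> `|s - t| < d ->
    rho t - eps <= rho s /\
    forall z z', z = f s /\ z' = f t \/ z = f t /\ z' = f s ->
    exists2 l, is_chain P z z' l & chain_cost z l <= (rho t + eps) * `|s - t|.
Proof.
move=> P0 cf cg txy dfg eps0 rho.
pose W := nn_weight P (f t); pose G := enorm (g t).
have W0 : 0 <= W := nn_weight_ge0 _ _.
have G0 : 0 <= G := enorm_ge0 _.
(* Chosen for [key], where $(W+7\eta)(G+\eta) = WG + \eta(W+7G+7\eta)$ and $\eta\le 1$. The 7 is 4
   from the Lipschitz constant of the weight, 2 from the quadratic term of the cost and 1 from the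
   choice of the tag. *)
pose eta := Num.min 1 (eps / (W + 7 * G + 7)).
have den0 : 0 < W + 7 * G + 7 by lra.
have eta0 : 0 < eta by rewrite lt_min ltr01 divr_gt0.
have eta1 : eta <= 1 by rewrite ge_min lexx.
have eta2 : eta * (W + 7 * G + 7) <= eps by rewrite -ler_pdivlMr// ge_min lexx orbT.
have key : (W + 7 * eta) * (G + eta) <= W * G + eps by nra.
have crho : {within `[x, y], continuous rho} by exact: within_continuous_density.
have cdist : {within `[x, y], continuous (fun s => enorm (f s - f t))}.
  move=> r; apply: (@continuous_comp (subspace `[x, y]) _ _ (fun s => f s - f t) (@enorm R k)).
    exact: (continuousB (cf r) (@cst_continuous _ _ (f t) _)).
  exact: enorm_continuous.
have txy' : `[x, y]%classic t by [].
have [d1 d1_gt0 hd1] := within_continuous_dist crho txy' eps0.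
have [d2 d2_gt0 hd2] := within_continuous_dist cdist txy' eta0.
have [d3 d3_gt0 hd3] : exists2 d, 0 < d & forall s, s \in `[x, y] -> `|s - t| < d ->
    enorm (f s - f t) <= (G + eta) * `|s - t|.
  have quot : enorm ((s - t)^-1 *: (f s - f t)) @[s --> within `[x, y] t^'] --> enorm (g t).
    exact: (cvg_comp _ _ dfg (@enorm_continuous _ _ (g t))).
  move/cvgrPdist_lt : quot => /(_ _ eta0) /nbhs_ballP[d d0 hd].
  exists d => // s sxy st; have [->|sNt] := eqVneq s t.
    by rewrite !subrr -(scale0r 0) enormZ normr0 mul0r mulr0.
  have := hd s _ sNt sxy; rewrite -ball_normE /= distrC => /(_ st).
  have st0 : 0 < `|s - t| by rewrite normr_gt0 subr_eq0.
  rewrite enormZ normfV ltr_norml -/G => /andP[lt_G _].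
  by rewrite mulrC -ler_pdivrMl//; lra.
exists (Num.min d1 (Num.min d2 d3)); first by rewrite !lt_min d1_gt0 d2_gt0.
move=> s sxy; rewrite !lt_min => /and3P[st1 st2 st3]; split.
  have := hd1 s sxy st1; rewrite ltr_norml => /andP[_ /ltW].
  by rewrite lerBlDl -lerBlDr.
pose n := enorm (f s - f t).
have n0 : 0 <= n := enorm_ge0 _.
have n1 : n <= eta.
  have := hd2 s sxy st2; rewrite subrr -(scale0r 0) enormZ normr0 mul0r sub0r normrN.
  by rewrite ger0_norm ?enorm_ge0// => /ltW.
have n2 : n <= (G + eta) * `|s - t| := hd3 s sxy st3.
move=> z z' zz'.
have nz : enorm (z' - z) = n by case: zz' => -[-> ->]; rewrite // enormB.
have Wz : nn_weight P z <= W + 4 * n.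
  have := nn_weight_lipschitz z (f t) P0.
  case: zz' => -[-> _] // _; rewrite -/W; lra.
have [p Pp pz] := nn_weight_adherent z P0 eta0.
exists [:: (p, z')]; first by split => // s'; rewrite inE => /eqP ->.
rewrite /= addr0 nz.
apply: (@le_trans _ _ ((W + 7 * eta) * n)); first by nra.
apply: (@le_trans _ _ ((W + 7 * eta) * (G + eta) * `|s - t|)); last by rewrite ler_wpM2r.
by rewrite -mulrA ler_wpM2l//; lra.
Qed.

End ChainAlongPath.

(** * From path lengths to the edge-squared metric *)

Section PathBound.
Context {R : realType} {k : nat}.
Implicit Types (P : set 'rV[R]_k) (l : seq ('rV[R]_k * 'rV[R]_k)) (f g : R -> 'rV[R]_k).
Local Notation mu := (@lebesgue_measure R).

(** Cost and integral are additive, so [segment_induction] glues the local steps. Near [t] the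
    density is at least [rho t - eps / 2] and a step costs at most [rho t + eps / 2] per unit of
    time: the loss is [eps] per unit of time. *)
Lemma C1_chain P f g (x y eps : R) : P !=set0 -> x <= y ->
  {within `[x, y], continuous f} -> {within `[x, y], continuous g} ->
  (forall t, t \in `[x, y] ->
    (fun s => (s - t)^-1 *: (f s - f t)) @ within `[x, y] t^' --> g t) ->
  0 < eps ->
  exists2 l, is_chain P (f x) (f y) l &
    ((chain_cost (f x) l)%:E <=
     \int[mu]_(t in `[x, y]) (nn_weight P (f t) * enorm (g t))%:E +
     (eps * (y - x))%:E)%E.
Proof.
move=> P0 xy cf cg dfg eps0.
pose rho t := nn_weight P (f t) * enorm (g t).
have rho0 t : 0 <= rho t by rewrite mulr_ge0 ?nn_weight_ge0 ?enorm_ge0.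
have mrho s t : x <= s -> t <= y -> measurable_fun `[s, t] rho.
  move=> xs ty; apply: (@measurable_funS _ _ _ _ `[x, y]) => //.
    by apply: subset_itv; rewrite bnd_simp.
  apply: subspace_continuous_measurable_fun => //.
  exact: within_continuous_density.
pose Q s t := exists2 l, is_chain P (f s) (f t) l &
  ((chain_cost (f s) l)%:E <= \int[mu]_(r in `[s, t]) (rho r)%:E + (eps * (t - s))%:E)%E.
apply: (@segment_induction R x y Q xy) => [s t u xs st tu uy [l1 c1 e1] [l2 c2 e2]|t txy].
  exists (l1 ++ l2); first exact: is_chain_cat c1 c2.
  have ty := le_trans tu uy; have xt := le_trans xs st.
  have [_ ->] := integral_itv_split st tu rho0 (mrho _ _ xs ty) (mrho _ _ xt uy).
  have -> : eps * (u - s) = eps * (t - s) + eps * (u - t) by ring.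
  by rewrite chain_cost_cat (proj2 c1) !EFinD addeACA leeD.
have txy' : t \in `[x, y] by rewrite in_itv.
have eps2 : 0 < eps / 2 by rewrite divr_gt0.
have [d d0 hd] := chain_step_local P0 cf cg txy' (dfg _ txy') eps2.
exists d => // s sxy std.
have near r : r \in `[x, y] -> `|r - t| < d -> rho t - eps / 2 <= rho r.
  by move=> rxy rtd; have [] := hd r rxy rtd.
have sxy' : s \in `[x, y] by rewrite in_itv.
have [_ step] := hd s sxy' std.
have [/andP[xs sy] /andP[xt ty]] := (sxy, txy).
(* Here [u] and [v] are [s] and [t] in increasing order, so that one argument covers both sides. *)
have close u v z z' : x <= u -> u <= v -> v <= y -> `|s - t| = v - u ->
    (forall r, u <= r <= v -> `|r - t| <= `|s - t|) ->
    f u = z /\ f v = z' /\ (z = f s /\ z' = f t \/ z = f t /\ z' = f s) ->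
    Q u v.
  move=> xu uv vy stE rt [uz [vz' zz']]; have [l lc lcost] := step z z' zz'.
  exists l; rewrite uz ?vz'//; apply: (@le_trans _ _ (((rho t - eps / 2) * (v - u))%:E +
      (eps * (v - u))%:E)%E).
    rewrite -EFinD lee_fin (le_trans lcost)// stE -mulrDl.
    by rewrite ler_wpM2r ?subr_ge0// /rho; lra.
  rewrite leeD2r// le_integral_itv//; first exact: mrho.
  move=> r; rewrite in_itv /= => /andP[ur rv]; apply: near.
    by rewrite in_itv /= (le_trans xu ur) (le_trans rv vy).
  by apply: le_lt_trans std; apply: rt; rewrite ur.
split=> [st|ts].
- apply: (close _ _ (f s) (f t)) => //; last by split => //; split => //; left.
    by rewrite ler0_norm ?subr_le0// opprB.
  by move=> r /andP[sr rt]; rewrite !ler0_norm ?subr_le0//; lra.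
- apply: (close _ _ (f t) (f s)) => //; last by split => //; split => //; right.
    by rewrite ger0_norm ?subr_ge0.
  by move=> r /andP[tr rs]; rewrite !ger0_norm ?subr_ge0//; lra.
Qed.

(** At an interior point, all small two-sided increments stay in the interval, so the restricted
    limit is the ordinary one after the shift [s = h + t]. *)
Lemma C1_derive1 f g (x y t : R) :
  (fun s => (s - t)^-1 *: (f s - f t)) @ within `[x, y] t^' --> g t ->
  t \in `]x, y[ -> derive1 f t = g t.
Proof.
move=> dfg txy; apply: cvg_lim => //.
have sh : (fun h => h + t) @ (0 : R)^' --> within `[x, y] t^'.
  move=> A; rewrite /within /= => /nbhs_ballP[d d0 hd].
  have txyn : nbhs t `]x, y[%classic by exact: near_in_itvoo.
  move/nbhs_ballP : txyn => [d' d'0 hd'].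
  apply/nbhs_ballP; exists (Num.min d d'); first by rewrite /= lt_min d0.
  move=> h; rewrite -ball_normE /= sub0r normrN lt_min => /andP[hd1 hd2] h0.
  apply: hd.
  - by rewrite -ball_normE /= opprD addrCA subrr addr0 normrN.
  - by rewrite -subr_eq0 addrK.
  - apply: subset_itv_oo_cc; apply: hd'.
    by rewrite -ball_normE /= opprD addrCA subrr addr0 normrN.
have := cvg_comp _ _ sh dfg.
by under [X in X @ _]funext do rewrite /= addrK.
Qed.

(** The integrands can differ only at [x] and [y], where [derive1 f] is uncontrolled, and these two
    points form a null set. *)
Lemma C1_density P f g (x y : R) : P !=set0 -> x <= y ->
  {within `[x, y], continuous f} -> {within `[x, y], continuous g} ->
  (forall t, t \in `[x, y] ->
    (fun s => (s - t)^-1 *: (f s - f t)) @ within `[x, y] t^' --> g t) ->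
  measurable_fun `[x, y] (fun t => nn_weight P (f t) * enorm (derive1 f t)) /\
  (\int[mu]_(t in `[x, y]) (nn_weight P (f t) * enorm (derive1 f t))%:E =
   \int[mu]_(t in `[x, y]) (nn_weight P (f t) * enorm (g t))%:E)%E.
Proof.
move=> P0 xy cf cg dfg.
pose rho t := nn_weight P (f t) * enorm (g t).
pose rho' t := nn_weight P (f t) * enorm (derive1 f t).
have rhoE : {in `]x, y[, rho' =1 rho}.
  move=> t txy; rewrite /rho' (@C1_derive1 f g x y)//; apply: dfg.
  exact: subset_itv_oo_cc.
have mrho : measurable_fun `]x, y[ rho.
  apply: (@measurable_funS _ _ _ _ `[x, y]) => //; first exact: subset_itv_oo_cc.
  apply: subspace_continuous_measurable_fun => //.
  exact: within_continuous_density.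
have mrho' : measurable_fun `]x, y[ rho'.
  by apply: eq_measurable_fun mrho => t /set_mem /rhoE.
split; first exact: (@measurable_fun_itv_cc _ x y false true).
exact: (@eq_integral_itv_bounded _ x y rho rho').
Qed.

(** Induction on the breakpoints. Measurability is carried along because the integral is split at
    each breakpoint. *)
Lemma piecewise_C1_chain P f (x : R) (s : seq R) (eps : R) : P !=set0 ->
  path <%R x s -> (forall i, (i < size s)%N -> C1_on f (nth 0 (x :: s) i) (nth 0 s i)) ->
  {within `[x, last x s], continuous f} -> 0 < eps ->
  let rho t := nn_weight P (f t) * enorm (derive1 f t) in
  measurable_fun `[x, last x s] rho /\
  exists2 l, is_chain P (f x) (f (last x s)) l &
    ((chain_cost (f x) l)%:E <=
     \int[mu]_(t in `[x, last x s]) (rho t)%:E + (eps * (last x s - x))%:E)%E.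
Proof.
move=> P0 + + + eps0 rho.
have rho0 t : 0 <= rho t by rewrite mulr_ge0 ?nn_weight_ge0 ?enorm_ge0.
elim: s x => [|y s IH] x /=.
  move=> _ _ _; split; first by rewrite set_itv1; exact: measurable_fun_set1.
  exists [::] => //; rewrite subrr mulr0 adde0; apply: integral_ge0 => t _.
  by rewrite lee_fin.
move=> /andP[xy ys] C1f cf.
have yl : y <= last y s by apply: (itv_partition_le (s := s)).
have [g [cg dfg]] := C1f 0%N isT.
have cfxy : {within `[x, y], continuous f}.
  by apply: continuous_subspaceW cf; apply: subset_itv; rewrite bnd_simp.
have cfyl : {within `[y, last y s], continuous f}.
  by apply: continuous_subspaceW cf; apply: subset_itv; rewrite bnd_simp// ltW.
have [mxy intE] := C1_density P0 (ltW xy) cfxy cg dfg.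
have [l1 c1 e1] := C1_chain P0 (ltW xy) cfxy cg dfg eps0.
have [i i_s|myl [l2 c2 e2]] := IH y ys _ cfyl; first exact: (C1f i.+1).
have [mxl ->] := integral_itv_split (ltW xy) yl rho0 mxy myl.
split=> //; exists (l1 ++ l2); first exact: is_chain_cat c1 c2.
have -> : eps * (last y s - x) = eps * (y - x) + eps * (last y s - y) by ring.
by rewrite chain_cost_cat (proj2 c1) !EFinD addeACA leeD// intE.
Qed.

Lemma nn_length_lower_bound P (phi : 'rV[R]_k -> R) (a b : 'rV[R]_k) f :
  (forall p q, P p -> P q -> phi q - phi p <= enorm (q - p) ^+ 2) ->
  P a -> P b -> C1_paths a b f -> ((phi b - phi a)%:E <= nn_length P f)%E.
Proof.
move=> phi_lip Pa Pb [cf [s [ps /eqP ls] C1f] f0 f1].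
apply/lee_addgt0Pr => eps eps0.
have P0 : P !=set0 by exists a.
have [|_ [l [tagP endE]]] := @piecewise_C1_chain P f 0 s eps P0 ps C1f _ eps0.
  by rewrite ls.
rewrite ls f0 f1 in endE *; rewrite subr0 mulr1; apply: le_trans.
rewrite lee_fin -[in leLHS]endE; by apply: (@chain_lower_bound _ _ P) => //; rewrite endE.
Qed.

Definition chain_sums P (a b : 'rV[R]_k) :=
  [set r | exists (m : nat) (p : nat -> 'rV[R]_k),
    [/\ p 0%N = a, p m = b, forall i, (i <= m)%N -> P (p i)
      & r = (\sum_(i < m) enorm (p i.+1 - p i) ^+ 2)%:E]].

Lemma chain_sums_extend P a b c r : P c -> chain_sums P a b r ->
  chain_sums P a c (r + (enorm (c - b) ^+ 2)%:E)%E.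
Proof.
move=> Pc [m [p [pa pb pP ->]]].
exists m.+1, (fun i => if (i <= m)%N then p i else c); split => [|||].
- by [].
- by rewrite ltnn.
- by move=> i _; case: ifP => // /pP.
rewrite big_ord_recr /= leqnn ltnn pb EFinD; congr (_%:E + _)%E.
by apply: eq_bigr => i _; rewrite ltn_ord ltnW.
Qed.

Lemma edge_squared_metric_step P a b c : P c ->
  (edge_squared_metric P a c <= edge_squared_metric P a b + (enorm (c - b) ^+ 2)%:E)%E.
Proof.
move=> Pc; rewrite -leeBlDr//; apply/ereal_infP => r rab; rewrite leeBlDr//.
apply: ge_ereal_inf; exists (r + (enorm (c - b) ^+ 2)%:E)%E => //.
exact: chain_sums_extend.
Qed.

Lemma edge_squared_metric_ge0 P a b : (0 <= edge_squared_metric P a b)%E.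
Proof.
apply/ereal_infP => _ [m [p [_ _ _ ->]]]; rewrite lee_fin.
by apply: sumr_ge0 => i _; exact: sqr_ge0.
Qed.

Lemma edge_squared_metric_refl P a : P a -> edge_squared_metric P a a = 0%E.
Proof.
move=> Pa; apply/eqP; rewrite eq_le edge_squared_metric_ge0 andbT.
apply: ge_ereal_inf; exists 0%E => //.
by exists 0%N, (fun=> a); rewrite big_ord0.
Qed.

Lemma edge_squared_le_nn P a b : P a -> P b ->
  (edge_squared_metric P a b <= nn_metric P a b)%E.
Proof.
move=> Pa Pb; apply/ereal_infP => _ [f fab <-].
(* The chain with the single edge from [a] to [p] makes the infimum finite, so [fine] loses nothing
   on [P]. *)
have fin p : P p -> edge_squared_metric P a p \is a fin_num.
  move=> Pp; rewrite ge0_fin_numE ?edge_squared_metric_ge0//.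
  apply: le_lt_trans (edge_squared_metric_step a a Pp) _.
  by rewrite edge_squared_metric_refl// add0e ltry.
pose phi p := fine (edge_squared_metric P a p).
have <- : (phi b - phi a)%:E = edge_squared_metric P a b.
  by rewrite /phi edge_squared_metric_refl// subr0 fineK// fin.
apply: nn_length_lower_bound => // p q Pp Pq.
by rewrite lerBlDl -lee_fin EFinD !fineK ?fin// edge_squared_metric_step.
Qed.

End PathBound.

(** * The upper bound by polylines *)

Section UpperBound.
Context {R : realType}.
Local Notation mu := (@lebesgue_measure R).

(** The difference quotient is within [K * |h|] of [D]. Applied to [ramp_taylor], this
    differentiates [ramp] with no case distinction where its two formulas meet. *)
Lemma is_derive_quadratic (F : R -> R) (t D K : R) :
  (forall s, `|F s - F t - D * (s - t)| <= K * (s - t) ^+ 2) -> is_derive t 1 F D.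
Proof.
move=> quad.
have K0 : 0 <= K.
  have := quad (t + 1); have -> : t + 1 - t = 1 by ring.
  by rewrite expr1n !mulr1 => /(le_trans (normr_ge0 _)).
have cvgD : h^-1 *: (F (h *: 1 + t) - F t) @[h --> (0 : R)^'] --> D.
  apply/cvgrPdist_le => eps eps0; apply/nbhs_ballP.
  have K1 : 0 < K + 1 by lra.
  exists (eps / (K + 1)); first by rewrite /= divr_gt0.
  move=> h; rewrite -ball_normE /= sub0r normrN ltr_pdivlMr// => heps h0.
  have nh : 0 < `|h| by rewrite normr_gt0.
  have := quad (h + t); rewrite addrK -[h ^+ 2]real_normK ?num_real// => qh.
  rewrite /GRing.scale /= mulr1 distrC.
  have -> : h^-1 * (F (h + t) - F t) - D = h^-1 * (F (h + t) - F t - D * h) by field.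
  rewrite normrM normfV ler_pdivrMl// (le_trans qh)//.
  by rewrite expr2 mulrCA ler_wpM2l//; lra.
split; first by apply/cvg_ex; exists D.
exact/cvg_lim.
Qed.

Lemma affine_continuous (m c : R) : continuous (fun t : R => m * t - c).
Proof.
move=> t; apply: (@continuousB R R^o R (fun t => m * t) (cst c)); last exact: cst_continuous.
by apply: (@continuousM R R (cst m) id) => //; exact: cst_continuous.
Qed.

Lemma dramp_continuous : continuous (@dramp R).
Proof.
move=> t; apply: (@continuousM R R (cst 4) (fun u => Num.min `|u| `|1 - u|)).
  exact: cst_continuous.
apply: (@continuous_min R R (fun u : R => `|u|) (fun u : R => `|1 - u|) t).
  exact: norm_continuous.
apply: (@continuous_comp _ _ _ (fun u : R => 1 - u) Num.norm); last exact: norm_continuous.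
by apply: (@continuousB R R^o R (cst 1) id) => //; exact: cst_continuous.
Qed.

Lemma dramp_affine_continuous (a m c : R) :
  continuous (fun t : R => a * dramp (m * t - c)).
Proof.
move=> t; apply: (@continuousM R R (cst a) (fun t => dramp (m * t - c))).
  exact: cst_continuous.
apply: (@continuous_comp R R R (fun t => m * t - c) (@dramp R)).
  exact: affine_continuous.
exact: dramp_continuous.
Qed.

(** The fundamental theorem of calculus for the primitive [F]. When [m * (y - x) = 1] the value is
    [c], since [ramp] rises by 1 between 0 and 1. *)
Lemma ramp_affine_integral (c m x y : R) : 0 < m -> x < y ->
  (\int[mu]_(t in `[x, y]) (c * m * dramp (m * t - m * x))%:E =
   (c * (ramp (m * (y - x)) - ramp 0))%:E)%E.
Proof.
move=> m0 xy; pose F t := c * ramp (m * t - m * x).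
have dF (t : R) : is_derive t 1 F (c * m * dramp (m * t - m * x)).
  apply: (@is_derive_quadratic _ _ _ (`|c| * (2 * m ^+ 2))) => s.
  have := ramp_taylor (m * t - m * x) (m * s - m * x).
  have -> : m * s - m * x - (m * t - m * x) = m * (s - t) by ring.
  move=> h; rewrite /F.
  have -> : c * ramp (m * s - m * x) - c * ramp (m * t - m * x) -
       c * m * dramp (m * t - m * x) * (s - t) =
     c * (ramp (m * s - m * x) - ramp (m * t - m * x) -
       dramp (m * t - m * x) * (m * (s - t))) by ring.
  rewrite normrM -[leRHS]mulrA ler_wpM2l//; apply: le_trans h _.
  by rewrite le_eqVlt; apply/orP; left; apply/eqP; ring.
have cF (t : R) : {for t, continuous F}.
  by apply/differentiable_continuous/derivable1_diffP; case: (dF t).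
rewrite (@continuous_FTC2 _ _ F x y xy).
- by rewrite -EFinB /F subrr -[m * y - _]mulrBr -mulrBr.
- exact/continuous_subspaceT/dramp_affine_continuous.
- split => [t _||]; first by case: (dF t).
  + exact/cvg_at_right_filter/cF.
  + exact/cvg_at_left_filter/cF.
- by move=> t _; rewrite derive1E; apply: derive_val.
Qed.

Context {k : nat}.
Implicit Types (P : set 'rV[R]_k) (p : nat -> 'rV[R]_k).

Definition clamp01 (u : R) : R := Num.max 0 (Num.min 1 u).

(** A single sum of clamped increments makes continuity immediate, with no gluing. On the piece
    number [j] the earlier increments are complete and the later ones are still 0. *)
Definition polyline p (m : nat) (t : R) : 'rV[R]_k :=
  p 0%N + \sum_(i < m) clamp01 (m%:R * t - i%:R) *: (p i.+1 - p i).

Lemma polylineE p m j (t : R) : (j < m)%N ->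
  t \in `[j%:R / m%:R, j.+1%:R / m%:R] ->
  polyline p m t = p j + (m%:R * t - j%:R) *: (p j.+1 - p j).
Proof.
move=> jm; have m0 : 0 < m%:R :> R by rewrite ltr0n (leq_ltn_trans _ jm).
rewrite in_itv /= ler_pdivrMr// ler_pdivlMr// [t * _]mulrC => /andP[jt tj].
rewrite /polyline -(big_mkord xpredT (fun i => clamp01 (m%:R * t - i%:R) *: (p i.+1 - p i))).
rewrite (big_cat_nat (leq0n j) (ltnW jm)) /= (big_ltn jm).
rewrite [X in _ + (_ + (_ + X))]big_nat_cond [X in _ + (_ + (_ + X))]big1; last first.
  move=> i /andP[/andP[ji _] _].
  have : j.+1%:R <= i%:R :> R by rewrite ler_nat.
  by move=> ji'; rewrite /clamp01 max_l ?scale0r// ge_min; apply/orP; right; lra.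
rewrite (@eq_big_nat _ _ _ 0 j _ (fun i => p i.+1 - p i)); last first.
  move=> i /andP[_ ij]; have : i.+1%:R <= j%:R :> R by rewrite ler_nat.
  rewrite -natr1 => ij'; rewrite /clamp01 min_l ?max_r ?scale1r//; lra.
rewrite telescope_sumr// addr0 addrA [p 0%N + _]addrC subrK; congr (_ + _ *: _).
by move: tj; rewrite -natr1 /clamp01 => tj; rewrite min_r ?max_r//; lra.
Qed.

Lemma clamp01_continuous : continuous clamp01.
Proof.
move=> t; apply: (@continuous_max R R (cst 0) (fun u => Num.min 1 u) t).
  exact: cst_continuous.
by apply: (@continuous_min R R (cst 1) id t) => //; exact: cst_continuous.
Qed.

Lemma polyline_continuous p m : continuous (polyline p m).
Proof.
have sum_cont : continuous
    (fun t : R => \sum_(i < m) clamp01 (m%:R * t - i%:R) *: (p i.+1 - p i)).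
  apply: continuous_big => [|i _]; first exact: add_continuous.
  move=> t; apply: (@continuousZ _ _ _ (fun t : R => clamp01 (m%:R * t - i%:R))
    (cst (p i.+1 - p i))); last exact: cst_continuous.
  apply: (@continuous_comp R R R (fun t : R => m%:R * t - i%:R) clamp01).
    exact: affine_continuous.
  exact: clamp01_continuous.
move=> t; apply: (@continuousD R _ R (cst (p 0%N))); first exact: cst_continuous.
exact: sum_cont.
Qed.

Lemma polyline_node p m j : (j <= m)%N -> (0 < m)%N -> polyline p m (j%:R / m%:R) = p j.
Proof.
move=> jm m0; have mR : 0 < m%:R :> R by rewrite ltr0n.
have scale i : m%:R * (i%:R / m%:R) = i%:R :> R by field; rewrite gt_eqF.
move: jm; rewrite leq_eqVlt => /predU1P[->|jm].
  case: m m0 mR scale => // m m0 mR scale.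
  rewrite (@polylineE _ _ m) ?scale ?in_itv /= ?lexx ?andbT//.
    by rewrite -natrB// subSnn scale1r addrC subrK.
  by rewrite ler_pM2r ?invr_gt0// ler_nat.
rewrite (@polylineE _ _ j) ?scale ?subrr ?scale0r ?addr0//.
by rewrite in_itv /= lexx ler_pM2r ?invr_gt0// ler_nat leqnSn.
Qed.

Lemma polyline_derive p m j (t : R) : (j < m)%N ->
  let x := j%:R / m%:R : R in let y := j.+1%:R / m%:R : R in
  t \in `[x, y] ->
  (fun s => (s - t)^-1 *: (polyline p m s - polyline p m t)) @ within `[x, y] t^' -->
    m%:R *: (p j.+1 - p j).
Proof.
move=> jm x y txy A /nbhs_singleton AG.
suff : nbhs t (fun s => s != t -> `[x, y]%classic s ->
    A ((s - t)^-1 *: (polyline p m s - polyline p m t))) by [].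
apply: (@filterE _ (nbhs t)) => s st sxy; rewrite !(@polylineE _ _ j)//.
rewrite opprD addrACA subrr add0r -scalerBl scalerA.
have -> // : (s - t)^-1 * (m%:R * s - j%:R - (m%:R * t - j%:R)) = m%:R :> R.
by field; rewrite subr_eq0.
Qed.

(** At parameter [u] on an edge of length [c] the two ends are at distances [|u| * c] and
    [|1 - u| * c], so the weight is at most [c * dramp u]. The speed is [m%:R * c], and integrating
    [dramp] over the edge leaves [c ^+ 2]. *)
Lemma polyline_piece P p m j : (j < m)%N -> P (p j) -> P (p j.+1) ->
  let x := j%:R / m%:R : R in let y := j.+1%:R / m%:R : R in
  let rho t := nn_weight P (polyline p m t) * enorm (derive1 (polyline p m) t) in
  measurable_fun `[x, y] rho /\
  (\int[mu]_(t in `[x, y]) (rho t)%:E <= (enorm (p j.+1 - p j) ^+ 2)%:E)%E.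
Proof.
move=> jm Pj Pj1 x y rho; set c := enorm (p j.+1 - p j).
have m0 : 0 < m%:R :> R by rewrite ltr0n (leq_ltn_trans _ jm).
have xy : x < y by rewrite ltr_pM2r ?invr_gt0// ltr_nat.
have P0 : P !=set0 by exists (p j).
have mx : m%:R * x = j%:R by rewrite /x; field; rewrite gt_eqF.
have my : m%:R * y = j.+1%:R by rewrite /y; field; rewrite gt_eqF.
pose g (_ : R) : 'rV[R]_k := m%:R *: (p j.+1 - p j).
have cf : {within `[x, y], continuous (polyline p m)}.
  exact/continuous_subspaceT/polyline_continuous.
have cg : {within `[x, y], continuous g}.
  by apply: continuous_subspaceT; exact: cst_continuous.
have [mrho ->] := @C1_density R k P _ g x y P0 (ltW xy) cf cg
  (fun t => @polyline_derive p m j t jm).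
split=> //.
apply: (@le_trans _ _
  (\int[mu]_(t in `[x, y]) (c ^+ 2 * m%:R * dramp (m%:R * t - m%:R * x))%:E)%E).
  apply: ge0_le_integral => //.
  - by move=> t _; rewrite lee_fin mulr_ge0 ?nn_weight_ge0 ?enorm_ge0.
  - apply/measurable_EFinP; apply: subspace_continuous_measurable_fun => //.
    exact: within_continuous_density.
  - apply/measurable_EFinP; apply: subspace_continuous_measurable_fun => //.
    exact/continuous_subspaceT/dramp_affine_continuous.
  move=> t txy; rewrite lee_fin /g enormZ -/c (gtr0_norm m0).
  have W : nn_weight P (polyline p m t) <= c * dramp (m%:R * t - m%:R * x).
    rewrite mx (polylineE p jm txy); set u := m%:R * t - j%:R.
    rewrite /dramp; case: (leP `|u| `|1 - u|) => _.
      apply: le_trans (nn_weight_le _ Pj) _.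
      by rewrite opprD addrA subrr add0r enormN enormZ -/c; lra.
    apply: le_trans (nn_weight_le _ Pj1) _.
    have -> : p j.+1 - (p j + u *: (p j.+1 - p j)) = (1 - u) *: (p j.+1 - p j).
      by rewrite opprD addrA [RHS]scalerBl scale1r.
    by rewrite enormZ -/c; lra.
  have mc0 : 0 <= m%:R * c by rewrite mulr_ge0 ?enorm_ge0.
  by apply: le_trans (ler_wpM2r mc0 W) _; rewrite le_eqVlt; apply/orP; left; apply/eqP; ring.
rewrite ramp_affine_integral//.
have -> : m%:R * (y - x) = 1 by rewrite mulrBr my mx -natr1; ring.
by rewrite ramp1 ramp0 subr0 mulr1.
Qed.

Lemma nn_metric_le_chain P p m : (0 < m)%N -> (forall i, (i <= m)%N -> P (p i)) ->
  (nn_metric P (p 0%N) (p m) <= (\sum_(i < m) enorm (p i.+1 - p i) ^+ 2)%:E)%E.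
Proof.
move=> m0 pP; have mR : 0 < m%:R :> R by rewrite ltr0n.
pose f := polyline p m.
pose rho t := nn_weight P (f t) * enorm (derive1 f t).
have rho0 t : 0 <= rho t by rewrite mulr_ge0 ?nn_weight_ge0 ?enorm_ge0.
have length_le j : (j <= m)%N -> measurable_fun `[(0 : R), j%:R / m%:R] rho /\
    (\int[mu]_(t in `[0%R, (j%:R / m%:R)%R]) (rho t)%:E <=
      (\sum_(i < j) enorm (p i.+1 - p i) ^+ 2)%:E)%E.
  elim: j => [|j IH] jm.
    rewrite mul0r set_itv1; split; first exact: measurable_fun_set1.
    by rewrite integral_set1 big_ord0.
  have [mj ij] := IH (ltnW jm).
  have [mj1 ij1] := @polyline_piece P p m j jm (pP _ (ltnW jm)) (pP _ jm).
  have j0 : 0 <= j%:R / m%:R :> R by rewrite divr_ge0.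
  have jj1 : j%:R / m%:R <= j.+1%:R / m%:R :> R by rewrite ler_pM2r ?invr_gt0// ler_nat.
  have [mS ->] := integral_itv_split j0 jj1 rho0 mj mj1.
  by split => //; rewrite big_ord_recr EFinD leeD.
apply: ge_ereal_inf; exists (nn_length P f); last first.
  have [_] := length_le m (leqnn m).
  by rewrite /nn_length divff ?gt_eqF.
exists f => //; split.
- exact/continuous_subspaceT/polyline_continuous.
(* The list of breakpoints omits the initial 0, so its entry [i] is [i.+1%:R / m%:R]; prepending 0
   realigns the indices. *)
- have sE i : (i <= m)%N ->
      nth 0 (0 :: [seq i.+1%:R / m%:R | i <- iota 0 m]) i = i%:R / m%:R :> R.
    case: i => [|i] im /=; first by rewrite mul0r.
    by rewrite (nth_map 0%N) ?size_iota// nth_iota.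
  exists [seq i.+1%:R / m%:R | i <- iota 0 m].
    split.
      apply/(pathP 0) => i; rewrite size_map size_iota => im.
      have := sE i.+1 im; rewrite /= => ->; rewrite sE; last exact: ltnW.
      by rewrite ltr_pM2r ?invr_gt0// ltr_nat.
    have := sE m (leqnn m); rewrite divff; last by rewrite gt_eqF.
    by rewrite (last_nth 0) size_map size_iota => ->.
  move=> i; rewrite size_map size_iota => im.
  have := sE i.+1 im; rewrite /= => ->; rewrite sE; last exact: ltnW.
  exists (fun=> m%:R *: (p i.+1 - p i)); split.
    by apply: continuous_subspaceT; exact: cst_continuous.
  by move=> t; exact: polyline_derive.
- by have := @polyline_node p m 0 (leq0n m) m0; rewrite mul0r.
- by have := @polyline_node p m m (leqnn m) m0; rewrite divff ?gt_eqF.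
Qed.

Lemma nn_le_edge_squared P (a b : 'rV[R]_k) :
  (nn_metric P a b <= edge_squared_metric P a b)%E.
Proof.
apply/ereal_infP => _ [[|m] [p [<- <- pP ->]]]; last exact: nn_metric_le_chain.
(* A chain without edges is replaced by one edge of length 0, because the parametrisation divides by
   the number of edges. *)
have := @nn_metric_le_chain P (fun=> p 0%N) 1 isT (fun _ _ => pP 0%N isT).
by rewrite big_ord1 subrr -(scale0r 0) enormZ normr0 mul0r expr0n big_ord0.
Qed.

End UpperBound.

Theorem theorem1p1 (R : realType) (k : nat) (hk : (1 <= k)%N)
    (n : nat) (hn : (1 <= n)%N) (C : 'I_n -> set 'rV[R]_k)
    (hcompact : forall i, compact (C i))
    (hconnected : forall i, path_connected R (C i))
    (P : set 'rV[R]_k) (hP : P = \bigcup_i C i) (hP0 : P !=set0)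
    (a b : 'rV[R]_k) (ha : P a) (hb : P b) :
  nn_metric P a b = edge_squared_metric P a b.
Proof.
by apply/eqP; rewrite eq_le nn_le_edge_squared edge_squared_le_nn.
Qed.
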